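(* Consider an infinite-horizon discounted MDP with $V_{\max}=R_{\max}/(1-\gamma)$ whose action space $\mathcal{A}\subset\mathbb{R}^m$ is convex and compact with diameter $B$ and positive finite Lebesgue measure $\nu(\mathcal{A})$; all policies have densities with respect to the Lebesgue measure $\nu$. Let $\mathcal{F}$ be a class of functions $\mathcal{S}\times\mathcal{A}\to[0,V_{\max}]$. Run PSPI for $K$ iterations: $\pi_1(a\mid s)=1/\nu(\mathcal{A})$ for all $s,a$; at iteration $k$ the critic outputs some $f_k\in\mathcal{F}$ (possibly history-dependent) and $\pi_{k+1}(a\mid s)\propto\pi_k(a\mid s)\exp(\eta f_k(s,a))$. Assume $f_k(s,\cdot)$ is $L$-Lipschitz for all $k$ and $s$. Then with step size $\eta=\sqrt{8m\log K/(KV_{\max}^2)}$, for any comparator policy $\pi_{\mathrm{cp}}$, $$\frac{\mathrm{Reg}_K}{K}\le V_{\max}\sqrt{\frac{m\log K}{2K}}+\frac{LB}{K},\qquad \mathrm{Reg}_K=\sum_{k=1}^K\mathbb{E}_{s\sim d^{\pi_{\mathrm{cp}}}}\bigl[f_k(s,\pi_{\mathrm{cp}})-f_k(s,\pi_k)\bigr].$$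
   Context: $d^\pi(s)$ is the state marginal of the discounted occupancy $d^\pi(s,a)=(1-\gamma)\sum_{t\ge0}\gamma^t\Pr_\pi(s_t=s,a_t=a)$; $f(s,\pi)=\mathbb{E}_{a\sim\pi(\cdot|s)}f(s,a)$. Lipschitz continuity and diameter are with respect to the Euclidean norm on $\mathbb{R}^m$. *)

(* Defs.v *)
From HB Require Import structures.
From mathcomp Require Import all_boot all_order all_algebra.
From mathcomp Require Import all_classical all_reals all_analysis.
Set Implicit Arguments. Unset Strict Implicit. Unset Printing Implicit Defensive.
Import Order.TTheory GRing.Theory Num.Theory.
Import numFieldNormedType.Exports.
Local Open Scope classical_set_scope.
Local Open Scope ring_scope.

Section Defs.
Variable R : realType.

Definition euclid (m : nat) (v : 'rV[R]_m) : R :=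
  Num.sqrt (\sum_(i < m) v ord0 i ^+ 2).

Definition diam (m : nat) (A : set 'rV[R]_m) : \bar R :=
  ereal_sup [set x | exists a b, A a /\ A b /\ x = (euclid (a - b))%:E].

(* Lebesgue integral over R^m of a (nonnegative) function, written as the
   iterated one-dimensional Lebesgue integral (Tonelli). *)
Fixpoint intRm (m : nat) : ('rV[R]_m -> \bar R) -> \bar R :=
  match m return ('rV[R]_m -> \bar R) -> \bar R with
  | 0 => fun f => f 0
  | m'.+1 => fun f =>
      (\int[@lebesgue_measure R]_x
         intRm (fun v : 'rV[R]_m' => f (row_mx (\row_(j < 1) x) v)))%E
  end.

Definition nu (m : nat) (A : set 'rV[R]_m) : \bar R :=
  intRm (fun a => (\1_A a)%:E).

Definition borelRV (m : nat) (U : set 'rV[R]_m) : Prop :=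
  <<s [set V : set 'rV[R]_m | open V] >> U.

Definition jmeasurable d (S : measurableType d) (m : nat)
  (g : S -> 'rV[R]_m -> R) : Prop :=
  forall B : set R, measurable B ->
    <<s [set C : set (S * 'rV[R]_m) |
          exists X U, measurable X /\ borelRV U /\ C = X `*` U] >>
      [set p | B (g p.1 p.2)].

Definition is_policy d (S : measurableType d) (m : nat) (A : set 'rV[R]_m)
  (pi : S -> 'rV[R]_m -> R) : Prop :=
  jmeasurable pi /\ (forall s a, 0 <= pi s a) /\
  (forall s, intRm (fun a => (\1_A a * pi s a)%:E) = 1%E).

Definition fpol d (S : measurableType d) (m : nat) (A : set 'rV[R]_m)
  (f pi : S -> 'rV[R]_m -> R) (s : S) : \bar R :=
  intRm (fun a => (\1_A a * pi s a * f s a)%:E).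

(* PSPI policies: pspi 0 = pi_1 (uniform on A), and
   pspi k.+1 = pi_{k+2} obtained from pspi k = pi_{k+1} and the critic output
   f k = f_{k+1}:  pi_{k+1}(a|s) ∝ pi_k(a|s) exp(eta f_k(s,a)). *)
Fixpoint pspi d (S : measurableType d) (m : nat) (A : set 'rV[R]_m) (eta : R)
  (f : nat -> S -> 'rV[R]_m -> R) (k : nat) : S -> 'rV[R]_m -> R :=
  match k with
  | 0 => fun s a => \1_A a / fine (nu A)
  | k'.+1 => fun s a =>
      let p := pspi A eta f k' in
      p s a * expR (eta * f k' s a) /
        fine (intRm (fun b => (\1_A b * p s b * expR (eta * f k' s b))%:E))
  end.

Definition Tpol d (S : measurableType d) (m : nat) (A : set 'rV[R]_m)
  (P : S -> 'rV[R]_m -> probability S R) (pi : S -> 'rV[R]_m -> R)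
  (h : S -> \bar R) (s : S) : \bar R :=
  intRm (fun a => ((\1_A a * pi s a)%:E * \int[P s a]_s' h s')%E).

(* E_{s ~ d^pi}[h] for h >= 0, with d^pi the state marginal of the
   discounted occupancy (1-gamma) sum_t gamma^t Pr_pi(s_t = .),
   s_0 ~ mu0. *)
Definition occ_exp_nn d (S : measurableType d) (m : nat) (A : set 'rV[R]_m)
  (mu0 : probability S R) (P : S -> 'rV[R]_m -> probability S R)
  (gamma : R) (pi : S -> 'rV[R]_m -> R) (h : S -> \bar R) : \bar R :=
  ((1 - gamma)%:E *
    \sum_(0 <= t <oo) ((gamma ^+ t)%:E *
                        \int[mu0]_s iter t (Tpol A P pi) h s))%E.

Definition occ_exp d (S : measurableType d) (m : nat) (A : set 'rV[R]_m)
  (mu0 : probability S R) (P : S -> 'rV[R]_m -> probability S R)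
  (gamma : R) (pi : S -> 'rV[R]_m -> R) (h : S -> \bar R) : \bar R :=
  (occ_exp_nn A mu0 P gamma pi (h^\+) - occ_exp_nn A mu0 P gamma pi (h^\-))%E.

(* Reg_K = sum_{k=1}^K E_{s ~ d^{pi_cp}} [f_k(s,pi_cp) - f_k(s,pi_k)],
   with f_k = f (k-1) and pi_k = pspi (k-1). *)
Definition regret d (S : measurableType d) (m : nat) (A : set 'rV[R]_m)
  (mu0 : probability S R) (P : S -> 'rV[R]_m -> probability S R)
  (gamma eta : R) (f : nat -> S -> 'rV[R]_m -> R)
  (picp : S -> 'rV[R]_m -> R) (K : nat) : \bar R :=
  (\sum_(k < K)
     occ_exp A mu0 P gamma picp
       (fun s => fpol A (f k) picp s - fpol A (f k) (pspi A eta f k) s))%E.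

End Defs.

(* Main.v *)
Require Import Defs.
From HB Require Import structures.
From mathcomp Require Import all_boot all_order all_algebra.
From mathcomp Require Import all_classical all_reals all_analysis.
From mathcomp Require Import measurable_realfun ring lra.
Import Order.TTheory GRing.Theory Num.Theory.
Import numFieldNormedType.Exports.
Local Open Scope classical_set_scope.
Local Open Scope ring_scope.
Set Implicit Arguments.
Unset Strict Implicit.

(** Fix a state.  The PSPI policies are exponential weights: [pi_(k+1)] has density
    proportional to [exp (eta * (f_1 + ... + f_k))] on [A], with normalizing constant
    [W_k].  Hoeffding's lemma gives
    [W_k <= W_(k-1) * exp (eta * f_k(s, pi_k) + eta^2 Vmax^2 / 8)].  Conversely, for
    [a] in [A] the set [(1 - 1/K) a + (1/K) A] lies in [A] by convexity, has volume
    [nu A / K^m], and on it the cumulative critic is at least its value at [a] minus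
    [L B]; hence [W_K >= nu A * K^-m * exp (eta * (sum_k f_k(s, a) - L B))].
    Comparing logarithms bounds the regret against every [a] uniformly in the state,
    and the bound is integrated against [pi_cp] and then against its occupancy
    measure, which is a monotone additive functional of total mass one.  When
    [eta = 0] (one iteration, dimension zero, or [Vmax = 0]) the bound is direct. *)

(** * Borel structure on row vectors *)

Definition borelRV_type (R : realType) (m : nat) :=
  g_sigma_algebraType [set V : set 'rV[R]_m | open V].
HB.instance Definition _ (R : realType) (m : nat) :=
  Measurable.on (borelRV_type R m).

Section borel_rV.
Context {R : realType}.

Lemma measurable_coord (m : nat) (i : 'I_m) :
  measurable_fun setT (fun v : borelRV_type R m => (v : 'rV[R]_m) ord0 i).
Proof.
apply: (measurability _ (RGenOpens.measurableE R)).
move=> _ [_ [a [b ->] <-]]; rewrite setTI; apply: sub_sigma_algebra => /=.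
by apply: open_comp => [v _|]; [exact: coord_continuous|exact: interval_open].
Qed.

(** Provides a countable base: rational centers and radii [1/(n+1)] suffice to exhaust every open
    set. *)
Lemma rational_box (m : nat) (V : set 'rV[R]_m) (v : 'rV[R]_m) :
  open V -> V v ->
  exists q : 'rV[rat]_m * nat,
    ball (map_mx (@ratr R) q.1) q.2.+1%:R^-1 v /\
    ball (map_mx (@ratr R) q.1) q.2.+1%:R^-1 `<=` V.
Proof.
move=> oV Vv.
have : nbhs v V by exact: open_nbhs_nbhs.
rewrite -nbhs_ballE => -[e /= e0 veV].
(* With radius below [e / 2], a box whose center is that close to [v] lies in the [e]-ball around
   [v] by the triangle inequality. *)
have [n ne] : exists n, n.+1%:R^-1 < e / 2 :> R.
  have [n _ nP] : \forall n \near \oo, n.+1%:R^-1 < e / 2 :> R.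
    by apply: near_infty_natSinv_lt (PosNum (divr_gt0 e0 (ltr0n R 2))).
  by exists n; apply: nP => /=.
have n0 : (0 : R) < n.+1%:R^-1 by rewrite invr_gt0.
have /choice[q qP] : forall i : 'I_m, exists r : rat,
    `|ratr r - v ord0 i| < n.+1%:R^-1.
  move=> i; have [] := @dense_rat R (ball (v ord0 i) n.+1%:R^-1).
  - by exists (v ord0 i); exact: ballxx.
  - exact: ball_open.
  - move=> x [/= vx [r _ rx]]; exists r; rewrite rx distrC.
    by move: vx; rewrite -ball_normE.
exists (\row_i q i, n) => /=.
have qv : ball (map_mx (@ratr R) (\row_i q i)) n.+1%:R^-1 v.
  split => // i j; rewrite !mxE -ball_normE /=.
  by rewrite (ord1 i); exact: qP.
split => // w qw; apply: veV.
apply: (@le_ball _ _ _ (n.+1%:R^-1 + n.+1%:R^-1)).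
  by rewrite [leRHS]splitr lerD// ltW.
by apply: ball_triangle qw; exact/ball_sym.
Qed.

(** An open set is a countable union of rational boxes, and the preimage of a box is a finite
    intersection of preimages under the coordinates. *)
Lemma measurable_rV d (T : measurableType d) (m : nat)
  (h : T -> borelRV_type R m) :
  (forall i, measurable_fun setT (fun t => (h t : 'rV[R]_m) ord0 i)) ->
  measurable_fun setT h.
Proof.
move=> mh.
apply: (@measurability _ _ T (borelRV_type R m) setT h
  [set V : set 'rV[R]_m | open V]) => //.
move=> _ [V oV <-]; rewrite setTI.
pose box (q : 'rV[rat]_m * nat) : set 'rV[R]_m :=
  ball (map_mx (@ratr R) q.1) q.2.+1%:R^-1.
pose F q : set T := [set t | box q `<=` V /\ box q (h t)].
rewrite (_ : h @^-1` V = \bigcup_q F q); last first.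
  apply/seteqP; split=> t /=.
  - by move=> /(rational_box oV)[q [qh qV]]; exists q.
  - by move=> [q _ [qV qh]]; exact: qV.
apply: countable_bigcupT_measurable => [|q]; first exact: countableP.
(* The condition [box q] inside [V] does not involve [t], so [F q] is either empty or the whole
   preimage of the box. *)
have [qV|qV] := pselect (box q `<=` V); last first.
  by rewrite (_ : F q = set0)//; apply/seteqP; split => // t [].
rewrite (_ : F q = \bigcap_(i in [set: 'I_m])
   ((fun t => (h t : 'rV[R]_m) ord0 i) @^-1`
     ball (ratr (q.1 ord0 i) : R) q.2.+1%:R^-1)); last first.
  apply/seteqP; split=> t /=.
  - by move=> [_ [_ qt]] i _ /=; have := qt ord0 i; rewrite mxE.
  - move=> qt; split => //; split => [|i j]; first by rewrite /= invr_gt0.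
    by rewrite (ord1 i) mxE; exact: qt.
apply: fin_bigcap_measurable => [|i _]; first exact: finite_finset.
rewrite -[X in measurable X]setTI; apply: mh => //.
by apply: open_measurable; exact: ball_open.
Qed.

(** This is the map by which [intRm] splits off the first coordinate, written on a product so that
    its joint measurability can be stated. *)
Definition consRV (m : nat) (p : R * borelRV_type R m) : borelRV_type R m.+1 :=
  row_mx (\row_(j < 1) p.1) (p.2 : 'rV[R]_m).

Lemma measurable_consRV (m : nat) :
  measurable_fun setT (@consRV m).
Proof.
apply: measurable_rV => i.
rewrite /consRV.
have [j|j] := @split_ordP 1 m i => ->.
  rewrite (_ : (fun t => _) = fst); first exact: measurable_fst.
  apply/funext => t.
  by apply: etrans (row_mxEl (\row_(j < 1) t.1) t.2 ord0 j) _; rewrite mxE.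
rewrite (_ : (fun t => _) =
   (fun v : borelRV_type R m => (v : 'rV[R]_m) ord0 j) \o snd).
  by apply: measurableT_comp; [exact: measurable_coord|exact: measurable_snd].
by apply/funext => t; exact: (row_mxEr (\row_(j < 1) t.1) t.2 ord0 j).
Qed.

Lemma compact_measurable_rV (m : nat) (A : set 'rV[R]_m) :
  compact A -> measurable (A : set (borelRV_type R m)).
Proof.
move=> cA; rewrite -[X in measurable X]setCK.
apply: measurableC; apply: sub_sigma_algebra => /=.
apply: closed_openC.
apply: compact_closed => //; exact: norm_hausdorff.
Qed.

(** The measurable rectangles that generate the sigma-algebra of [jmeasurable] are measurable in the
    product space. *)
Lemma jmeasurable_fun d (S : measurableType d) (m : nat)
  (g : S -> 'rV[R]_m -> R) : jmeasurable g ->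
  measurable_fun setT (fun p : S * borelRV_type R m => g p.1 p.2).
Proof.
move=> mg _ B mB; rewrite setTI.
have := mg _ mB; apply: smallest_sub; first exact: sigma_algebra_measurable.
by move=> _ [X [U [mX [mU ->]]]]; exact: measurableX.
Qed.

End borel_rV.

(** * The iterated Lebesgue integral: measurability, linearity, affine substitution *)

Section intRm_theory.
Context {R : realType}.
Local Open Scope ereal_scope.
Local Notation mu := (@lebesgue_measure R).

Lemma intRm_ge0 (m : nat) (f : 'rV[R]_m -> \bar R) :
  (forall v, 0 <= f v) -> 0 <= intRm f.
Proof.
elim: m f => [|m IH] f f0 /=; first exact: f0.
by apply: integral_ge0 => x _; exact: IH.
Qed.

(** The induction on [m] keeps the parameter space [T] general: the first coordinate joins the
    parameters, the induction hypothesis is used over [T * R], and Tonelli handles the remaining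
    integral over [R]. *)
Lemma measurable_intRm d (T : measurableType d) (m : nat)
  (g : T * borelRV_type R m -> \bar R) :
  measurable_fun setT g -> (forall p, 0 <= g p) ->
  measurable_fun setT (fun t => intRm (fun v => g (t, v))).
Proof.
elim: m d T g => [|m IH] d T g mg g0 /=.
  exact: (measurableT_comp mg (measurable_pair2 _)).
have h0 (p : (T * R) * borelRV_type R m) : 0 <= g (p.1.1, consRV (p.1.2, p.2)).
  exact: g0.
have /IH : measurable_fun setT
    (fun p : (T * R) * borelRV_type R m => g (p.1.1, consRV (p.1.2, p.2))).
  apply: measurableT_comp mg _; apply: measurable_fun_pair.
    by apply: measurableT_comp; [exact: measurable_fst|exact: measurable_fst].
  apply: (measurableT_comp (@measurable_consRV R m)).
  apply: measurable_fun_pair; last exact: measurable_snd.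
  by apply: measurableT_comp; [exact: measurable_snd|exact: measurable_fst].
move=> /(_ h0) mG.
by have := measurable_fun_fubini_tonelli_F (m2 := mu) _ mG
  (fun p => intRm_ge0 (fun v => g0 _)).
Qed.

Lemma measurable_consRV2 (m : nat) (x : R) :
  measurable_fun setT
    (fun v : borelRV_type R m => consRV (x, v) : borelRV_type R m.+1).
Proof. exact: (measurableT_comp (@measurable_consRV R m) (measurable_pair1 x)). Qed.

Lemma measurable_intRm_section (m : nat) (f : borelRV_type R m.+1 -> \bar R) :
  measurable_fun setT f -> (forall v, 0 <= f v) ->
  measurable_fun setT (fun x : R =>
    intRm (fun v : 'rV[R]_m => f (row_mx (\row_(j < 1) x) v))).
Proof.
move=> mf f0.
by have := measurable_intRm (measurableT_comp mf (@measurable_consRV R m))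
  (fun p => f0 _).
Qed.

Lemma eq_intRm (m : nat) (f g : 'rV[R]_m -> \bar R) : f =1 g -> intRm f = intRm g.
Proof. by move=> /funext ->. Qed.

Lemma le_intRm (m : nat) (f g : borelRV_type R m -> \bar R) :
  measurable_fun setT f -> measurable_fun setT g ->
  (forall v, 0 <= f v) -> (forall v, f v <= g v) -> intRm f <= intRm g.
Proof.
elim: m f g => [|m IH] f g mf mg f0 fg /=; first exact: fg.
have g0 v : 0 <= g v by exact: le_trans (fg v).
apply: ge0_le_integral => //.
- by move=> x _; exact: intRm_ge0.
- exact: measurable_intRm_section.
- exact: measurable_intRm_section.
- move=> x _; apply: IH => //.
  + exact: (measurableT_comp mf (@measurable_consRV2 m x)).
  + exact: (measurableT_comp mg (@measurable_consRV2 m x)).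
Qed.

Lemma intRmD (m : nat) (f g : borelRV_type R m -> \bar R) :
  measurable_fun setT f -> measurable_fun setT g ->
  (forall v, 0 <= f v) -> (forall v, 0 <= g v) ->
  intRm (fun v => f v + g v) = intRm f + intRm g.
Proof.
elim: m f g => [//|m IH] f g mf mg f0 g0 /=.
rewrite -ge0_integralD//.
- apply: eq_integral => x _; apply: IH => //.
  + exact: (measurableT_comp mf (@measurable_consRV2 m x)).
  + exact: (measurableT_comp mg (@measurable_consRV2 m x)).
- by move=> x _; exact: intRm_ge0.
- exact: measurable_intRm_section.
- by move=> x _; exact: intRm_ge0.
- exact: measurable_intRm_section.
Qed.

Lemma intRmZl (m : nat) (k : \bar R) (f : borelRV_type R m -> \bar R) :
  measurable_fun setT f -> 0 <= k -> (forall v, 0 <= f v) ->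
  intRm (fun v => k * f v) = k * intRm f.
Proof.
elim: m f => [//|m IH] f mf k0 f0 /=.
rewrite -ge0_integralZl//.
- apply: eq_integral => x _; apply: IH => //.
  exact: (measurableT_comp mf (@measurable_consRV2 m x)).
- exact: measurable_intRm_section.
- by move=> x _; exact: intRm_ge0.
Qed.

(** The pushforward of Lebesgue measure under [c + e * x], scaled by [e], agrees with Lebesgue
    measure on half-open intervals, hence everywhere by uniqueness. *)
Lemma ge0_integral_affine (c e : R) (f : R -> \bar R) : (0 < e)%R ->
  measurable_fun setT f -> (forall x, 0 <= f x) ->
  e%:E * \int[mu]_x f (c + e * x)%R = \int[mu]_x f x.
Proof.
move=> e0 mf f0.
pose phi : measurableTypeR R -> measurableTypeR R := fun x => (c + e * x)%R.
have mphi : measurable_fun setT phi.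
  by apply: measurable_funD => //; exact: mulrl_measurable.
rewrite -(@ge0_integral_pushforward _ _ _ _ R phi mphi mu setT f) //; last first.
pose en : {nonneg R} := NngNum (ltW e0).
rewrite -[X in X%:E * _]/(en%:num)%R -ge0_integral_mscale//.
apply: eq_measure_integral => //= X mX _.
apply/esym/lebesgue_measure_unique => //= _ [[a b]] _ <-.
rewrite /mscale/= /pushforward/=.
rewrite (_ : phi @^-1` _ = `]((a - c) / e)%R, ((b - c) / e)%R]%classic); last first.
  apply/seteqP; split=> x /=; rewrite /phi !in_itv/= ltr_pdivrMr// ler_pdivlMr//.
    by rewrite ltrBlDl lerBrDl mulrC.
  by rewrite ltrBlDl lerBrDl [(x * e)%R]mulrC.
rewrite !lebesgue_measure_itv/= !lte_fin ltr_pM2r ?invr_gt0// ltrD2r.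
case: ifPn => _; last by rewrite mule0.
rewrite -!EFinB -EFinM; congr EFin.
by rewrite -mulrBl mulrCA mulfV ?gt_eqF// mulr1 opprB addrA subrK.
Qed.

(** The substitution is made one coordinate at a time, each contributing one factor [e]; the first
    coordinate uses the one-dimensional rule, the others the induction hypothesis with offset
    [c']. *)
Lemma intRm_affine (m : nat) (c : 'rV[R]_m) (e : R)
  (f : borelRV_type R m -> \bar R) : (0 < e)%R ->
  measurable_fun setT f -> (forall v, 0 <= f v) ->
  (e ^+ m)%:E * intRm (fun v => f (c + e *: v)%R) = intRm f.
Proof.
move=> e0; elim: m c f => [|m IH] c f mf f0 /=.
  by rewrite expr0 mul1e; congr f; apply/matrixP => i [].
pose c0 : R := c ord0 ord0.
pose c' : 'rV[R]_m := rsubmx (c : 'rV[R]_(1 + m)).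
pose G (y : R) := intRm (fun v : 'rV[R]_m => f (row_mx (\row_(j < 1) y) v)).
have mG : measurable_fun setT G by exact: measurable_intRm_section.
have G0 y : 0 <= G y by exact: intRm_ge0.
rewrite -[RHS](ge0_integral_affine c0 e0)//.
rewrite exprS EFinM -muleA; congr (_ * _).
have affE (x : R) (v : 'rV[R]_m) :
    ((c : 'rV[R]_(1 + m)) + e *: row_mx (\row_(j < 1) x) v)%R =
    row_mx (\row_(j < 1) (c0 + e * x)%R) (c' + e *: v)%R.
  rewrite -[c in LHS](@hsubmxK _ 1 1 m) scale_row_mx add_row_mx; congr row_mx.
  by apply/matrixP => i j; rewrite !mxE !ord1; congr (c _ _ + _)%R; exact/val_inj.
have ms (x : R) : measurable_fun setT (fun v : borelRV_type R m =>
    f (row_mx (\row_(j < 1) x) v)).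
  exact: (measurableT_comp mf (@measurable_consRV2 m x)).
have mA : measurable_fun setT (fun p : R * borelRV_type R m =>
   (c' + e *: (p.2 : 'rV[R]_m))%R : borelRV_type R m).
  apply: measurable_rV => i.
  rewrite (_ : (fun t => _) = (fun p => c' ord0 i + e * (p.2 : 'rV[R]_m) ord0 i)%R).
    apply: measurable_funD => //; apply: measurable_funM => //.
    by apply: (measurableT_comp (measurable_coord i)); exact: measurable_snd.
  by apply/funext => t; rewrite !mxE.
rewrite -ge0_integralZl//.
- apply: eq_integral => x _.
  rewrite -[RHS](IH c')//.
  congr (_ * _); apply: eq_intRm => v.
  by rewrite (affE x v).
- rewrite (_ : (fun x => _) = (fun x => intRm (fun v : 'rV[R]_m =>
      f (row_mx (\row_(j < 1) (c0 + e * x)%R) (c' + e *: v)%R)))); last first.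
    by apply/funext => x; apply: eq_intRm => v; rewrite (affE x v).
  apply: (@measurable_intRm _ R m (fun p : R * borelRV_type R m =>
    f (row_mx (\row_(j < 1) (c0 + e * p.1)%R) (c' + e *: (p.2 : 'rV[R]_m))%R)))
    => //.
  apply: (measurableT_comp mf).
  apply: (measurableT_comp (@measurable_consRV R m)
    (g := fun p : R * borelRV_type R m =>
      ((c0 + e * p.1)%R, (c' + e *: (p.2 : 'rV[R]_m))%R : borelRV_type R m))).
  apply: measurable_fun_pair => //.
  by apply: measurable_funD => //; apply: measurable_funM.
- by move=> x _; exact: intRm_ge0.
- by rewrite lee_fin exprn_ge0// ltW.
Qed.

Lemma intRm0 (m : nat) : intRm (fun _ : 'rV[R]_m => 0) = 0.
Proof. by elim: m => [//|m IH] /=; rewrite IH integral0. Qed.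

Lemma nu_gt0_nonempty (m : nat) (A : set 'rV[R]_m) : 0 < nu A -> exists a, A a.
Proof.
move=> nuA; have [//|nA] := pselect (exists a, A a).
move: nuA; rewrite /nu (_ : (fun a => _) = fun=> 0) ?intRm0 ?ltxx//.
by apply/funext => a; rewrite indicE memNset// => Aa; apply: nA; exists a.
Qed.

End intRm_theory.

(** * The discounted occupancy as a monotone additive functional *)

Section occupancy.
Context {R : realType} d (S : measurableType d) (m : nat).
Variables (mu0 : probability S R) (P : S -> 'rV[R]_m -> probability S R).
Variables (gamma : R) (A : set 'rV[R]_m) (pi : S -> 'rV[R]_m -> R).
Hypothesis gamma01 : 0 <= gamma < 1.
Hypothesis mP : forall X, measurable X -> jmeasurable (fun s a => fine (P s a X)).
Hypothesis mA : measurable (A : set (borelRV_type R m)).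
Hypothesis pi_policy : is_policy A pi.
Local Open Scope ereal_scope.

Lemma measurable_weight :
  measurable_fun setT (fun p : S * borelRV_type R m => (\1_A p.2 * pi p.1 p.2)%R).
Proof.
have [mpi _] := pi_policy.
apply: measurable_funM; last exact: jmeasurable_fun.
exact: (measurableT_comp (f := \1_A : borelRV_type R m -> R)).
Qed.

Lemma weight_ge0 s a : (0 <= \1_A a * pi s a)%R.
Proof. by have [_ [pi0 _]] := pi_policy; rewrite mulr_ge0. Qed.

Let integrand (h : S -> \bar R) (p : S * borelRV_type R m) : \bar R :=
  (\1_A p.2 * pi p.1 p.2)%:E * \int[P p.1 p.2]_s' h s'.

Let integrand_ge0 h p : (forall s, 0 <= h s) -> 0 <= integrand h p.
Proof.
move=> h0; apply: mule_ge0; first by rewrite lee_fin weight_ge0.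
exact: integral_ge0.
Qed.

(** By [mP], [P] is a measurable kernel from state-action pairs, so its integral of [h] is jointly
    measurable in the pair. *)
Let measurable_integrand h : measurable_fun setT h -> (forall s, 0 <= h s) ->
  measurable_fun setT (integrand h).
Proof.
move=> mh h0; apply: emeasurable_funM.
  by apply/measurable_EFinP; exact: measurable_weight.
apply: (measurable_fun_integral_kernel
  (l := fun p : S * borelRV_type R m => P p.1 p.2)) => // U mU.
rewrite (_ : (fun x => _) =
    EFin \o (fun p : S * borelRV_type R m => fine (P p.1 p.2 U))).
  by apply/measurable_EFinP; apply: jmeasurable_fun (mP mU).
by apply/funext => p /=; rewrite fineK// fin_num_measure.
Qed.

Let measurable_integrand2 h s : measurable_fun setT h -> (forall s, 0 <= h s) ->
  measurable_fun setT (fun a : borelRV_type R m => integrand h (s, a)).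
Proof. by move=> mh h0; apply: measurable_fun_pair2; exact: measurable_integrand. Qed.

Local Notation T := (Tpol A P pi).

Lemma Tpol_ge0 h s : (forall s, 0 <= h s) -> 0 <= T h s.
Proof. by move=> h0; apply: intRm_ge0 => a; exact: (integrand_ge0 (s, a)). Qed.

Lemma measurable_Tpol h : measurable_fun setT h -> (forall s, 0 <= h s) ->
  measurable_fun setT (T h).
Proof.
move=> mh h0; apply: (measurable_intRm (measurable_integrand mh h0)) => p.
exact: integrand_ge0.
Qed.

Lemma le_Tpol g h s : measurable_fun setT g -> measurable_fun setT h ->
  (forall s, 0 <= g s) -> (forall s, g s <= h s) -> T g s <= T h s.
Proof.
move=> mg mh g0 gh; have h0 s' : 0 <= h s' by exact: le_trans (gh s').
apply: le_intRm => [| |a|a].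
- exact: (measurable_integrand2 s mg).
- exact: (measurable_integrand2 s mh).
- exact: (integrand_ge0 (s, a)).
- apply: lee_wpmul2l; first by rewrite lee_fin weight_ge0.
  by apply: ge0_le_integral.
Qed.

Lemma TpolD g h s : measurable_fun setT g -> measurable_fun setT h ->
  (forall s, 0 <= g s) -> (forall s, 0 <= h s) ->
  T (fun s => g s + h s) s = T g s + T h s.
Proof.
move=> mg mh g0 h0; rewrite /Tpol -intRmD.
- apply: eq_intRm => a; rewrite ge0_integralD// ge0_muleDr//; exact: integral_ge0.
- exact: (measurable_integrand2 s mg).
- exact: (measurable_integrand2 s mh).
- by move=> a; exact: (integrand_ge0 (s, a)).
- by move=> a; exact: (integrand_ge0 (s, a)).
Qed.

Lemma Tpol_cst (c : R) s : (0 <= c)%R -> T (fun=> c%:E) s = c%:E.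
Proof.
move=> c0; have [_ [_ pi1]] := pi_policy.
rewrite /Tpol (_ : (fun a => _) = (fun a => c%:E * (\1_A a * pi s a)%:E)).
  rewrite intRmZl ?pi1 ?mule1//.
  - apply/measurable_EFinP; exact: (measurable_fun_pair2 s measurable_weight).
  - by move=> a; rewrite lee_fin weight_ge0.
by apply/funext => a; rewrite integral_cst//= probability_setT mule1 muleC.
Qed.

Lemma iter_Tpol t h : measurable_fun setT h -> (forall s, 0 <= h s) ->
  measurable_fun setT (iter t T h) /\ forall s, 0 <= iter t T h s.
Proof.
move=> mh h0; elim: t => [//|t [mt t0]] /=; split.
  exact: measurable_Tpol.
by move=> s; exact: Tpol_ge0.
Qed.

Lemma le_iter_Tpol t g h : measurable_fun setT g -> measurable_fun setT h ->
  (forall s, 0 <= g s) -> (forall s, g s <= h s) ->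
  forall s, iter t T g s <= iter t T h s.
Proof.
move=> mg mh g0 gh; have h0 s' : 0 <= h s' by exact: le_trans (gh s').
elim: t => [//|t IH] s /=.
have [mgt gt0] := iter_Tpol t mg g0; have [mht _] := iter_Tpol t mh h0.
exact: le_Tpol.
Qed.

Lemma iter_TpolD t g h : measurable_fun setT g -> measurable_fun setT h ->
  (forall s, 0 <= g s) -> (forall s, 0 <= h s) ->
  forall s, iter t T (fun s => g s + h s) s = iter t T g s + iter t T h s.
Proof.
move=> mg mh g0 h0; elim: t => [//|t IH] s /=.
have [mgt gt0] := iter_Tpol t mg g0; have [mht ht0] := iter_Tpol t mh h0.
by rewrite (funext IH) TpolD.
Qed.

Lemma iter_Tpol_cst t (c : R) s : (0 <= c)%R -> iter t T (fun=> c%:E) s = c%:E.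
Proof.
move=> c0; elim: t s => [//|t IH] s /=.
by rewrite (funext IH) Tpol_cst.
Qed.

Local Notation E := (occ_exp_nn A mu0 P gamma pi).

Let gamma_ge0 t : 0 <= (gamma ^+ t)%:E.
Proof. by rewrite lee_fin exprn_ge0//; case/andP: gamma01. Qed.

Let gamma1 : 0 <= (1 - gamma)%:E.
Proof. by rewrite lee_fin subr_ge0 ltW//; case/andP: gamma01. Qed.

Let term_ge0 t h : measurable_fun setT h -> (forall s, 0 <= h s) ->
  0 <= (gamma ^+ t)%:E * \int[mu0]_s iter t T h s.
Proof.
move=> mh h0; apply: mule_ge0 => //; apply: integral_ge0 => s _.
by have [_] := iter_Tpol t mh h0.
Qed.

Lemma occ_exp_nn_ge0 h : measurable_fun setT h -> (forall s, 0 <= h s) ->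
  0 <= E h.
Proof.
by move=> mh h0; apply: mule_ge0 => //; apply: nneseries_ge0 => t _ _; exact: term_ge0.
Qed.

Lemma le_occ_exp_nn g h : measurable_fun setT g -> measurable_fun setT h ->
  (forall s, 0 <= g s) -> (forall s, g s <= h s) -> E g <= E h.
Proof.
move=> mg mh g0 gh; have h0 s' : 0 <= h s' by exact: le_trans (gh s').
apply: lee_wpmul2l => //; apply: lee_nneseries => [t _ _|t _].
  exact: term_ge0.
apply: lee_wpmul2l => //.
have [mgt gt0] := iter_Tpol t mg g0; have [mht _] := iter_Tpol t mh h0.
by apply: ge0_le_integral => // s _; exact: le_iter_Tpol.
Qed.

Lemma occ_exp_nnD g h : measurable_fun setT g -> measurable_fun setT h ->
  (forall s, 0 <= g s) -> (forall s, 0 <= h s) ->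
  E (fun s => g s + h s) = E g + E h.
Proof.
move=> mg mh g0 h0; rewrite /occ_exp_nn -ge0_muleDr; last 2 first.
- by apply: nneseries_ge0 => t _ _; exact: term_ge0.
- by apply: nneseries_ge0 => t _ _; exact: term_ge0.
rewrite -nneseriesD; last 2 first.
- by move=> t _ _; exact: term_ge0.
- by move=> t _ _; exact: term_ge0.
congr (_ * _); apply: eq_eseriesr => t _.
have [mgt gt0] := iter_Tpol t mg g0; have [mht ht0] := iter_Tpol t mh h0.
rewrite (funext (iter_TpolD t mg mh g0 h0)) ge0_integralD// ge0_muleDr//;
  exact: integral_ge0.
Qed.

(** The occupancy has total mass one: every iterate of the transition operator fixes constants, and
    the factor [1 - gamma] cancels the sum of the geometric series. *)
Lemma occ_exp_nn_cst (c : R) : (0 <= c)%R -> E (fun=> c%:E) = c%:E.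
Proof.
move=> c0; case/andP: gamma01 => g0 g1.
have g_neq1 : (1 - gamma != 0)%R by rewrite subr_eq0 eq_sym lt_eqF.
rewrite /occ_exp_nn (eq_eseriesr (g := fun t => (geometric c gamma t)%:E)).
  have cvgG : series (geometric c gamma) @ \oo --> (c * (1 - gamma)^-1)%R.
    by apply: cvg_geometric_series; rewrite ger0_norm.
  have -> : \sum_(0 <= t <oo) (geometric c gamma t)%:E = (c / (1 - gamma))%:E.
    apply/cvg_lim => //.
    rewrite (_ : (fun n => _) = EFin \o series (geometric c gamma)).
      by apply: cvg_EFin; [exact: nearW|exact: cvgG].
    by apply/funext => n /=; rewrite /series/= sumEFin.
  by rewrite -EFinM mulrC divfK.
move=> t _; rewrite (_ : iter t T _ = fun=> c%:E).
  by rewrite integral_cst//= probability_setT mule1 -EFinM /geometric/= mulrC.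
by apply/funext => s; exact: iter_Tpol_cst.
Qed.

Lemma occ_exp_nn_sum (K : nat) (h : nat -> S -> \bar R) :
  (forall k, measurable_fun setT (h k)) -> (forall k s, 0 <= h k s) ->
  E (fun s => \sum_(k < K) h k s) = \sum_(k < K) E (h k).
Proof.
move=> mh h0; elim: K => [|K IH].
  rewrite big_ord0 -[RHS](occ_exp_nn_cst (lexx 0%R)); congr E.
  by apply/funext => s; rewrite big_ord0.
rewrite big_ord_recr/= -IH -occ_exp_nnD//.
- by congr E; apply/funext => s; rewrite big_ord_recr.
- exact: emeasurable_sum.
- by move=> s; exact: sume_ge0.
Qed.

(** [occ_exp] is a difference of expectations of positive and negative parts, so linearity is not
    immediate. The uniform bound [V] makes all these expectations finite, and the claim becomes an
    inequality between expectations of nonnegative functions. *)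
Lemma sum_occ_exp_le (K : nat) (h : nat -> S -> \bar R) (V C : R) :
  (0 <= V)%R -> (0 <= C)%R ->
  (forall k, measurable_fun setT (h k)) ->
  (forall k s, `|h k s| <= V%:E) ->
  (forall s, \sum_(k < K) h k s <= C%:E) ->
  \sum_(k < K) occ_exp A mu0 P gamma pi (h k) <= C%:E.
Proof.
move=> V0 C0 mh hV hC.
have mp k : measurable_fun setT ((h k)^\+) by exact: measurable_funepos.
have mn k : measurable_fun setT ((h k)^\-) by exact: measurable_funeneg.
have p0 k s : 0 <= (h k)^\+ s by exact: funepos_ge0.
have n0 k s : 0 <= (h k)^\- s by exact: funeneg_ge0.
have pn k s : (h k)^\+ s + (h k)^\- s = `|h k s|.
  by rewrite -[RHS]/((abse \o h k) s) fune_abse.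
have pV k s : (h k)^\+ s <= V%:E.
  by apply: le_trans (hV k s); rewrite -pn leeDl.
have nV k s : (h k)^\- s <= V%:E.
  by apply: le_trans (hV k s); rewrite -pn leeDr.
have fin_le (x : \bar R) : 0 <= x -> x <= V%:E -> x \is a fin_num.
  by move=> x0 xV; rewrite ge0_fin_numE// (le_lt_trans xV) ?ltry.
have pf k s : (h k)^\+ s \is a fin_num by exact: fin_le.
have nf k s : (h k)^\- s \is a fin_num by exact: fin_le.
have Ef g : measurable_fun setT g -> (forall s, 0 <= g s) ->
    (forall s, g s <= V%:E) -> E g \is a fin_num.
  move=> mg g0 gV; apply: fin_le; first exact: occ_exp_nn_ge0.
  by rewrite -(occ_exp_nn_cst V0); exact: le_occ_exp_nn.
have -> : \sum_(k < K) occ_exp A mu0 P gamma pi (h k) =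
    \sum_(k < K) E ((h k)^\+) - \sum_(k < K) E ((h k)^\-).
  by rewrite /occ_exp big_split/= sumeN// => i j _ _;
    rewrite fin_num_adde_defr// Ef.
rewrite leeBlDr; last by apply/sum_fin_numP => i _ _; exact: Ef.
rewrite -(occ_exp_nn_sum K (h := fun k => (h k)^\+))//.
rewrite -(occ_exp_nn_sum K (h := fun k => (h k)^\-))//.
(* With [C] read as its own expectation, it remains to compare pointwise the sum of positive parts
   with [C] plus the sum of negative parts. *)
rewrite -[in leRHS](occ_exp_nn_cst C0) -occ_exp_nnD//.
- apply: le_occ_exp_nn => //.
  + exact: emeasurable_sum.
  + by apply: emeasurable_funD => //; exact: emeasurable_sum.
  + by move=> s; exact: sume_ge0.
  + move=> s; rewrite -leeBlDr; last exact/sum_fin_numP.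
    apply: le_trans (hC s).
    rewrite -sumeN; last by move=> i j _ _; rewrite fin_num_adde_defr.
    rewrite -big_split/=; apply: lee_sum => i _.
    by rewrite [in leRHS](funeposneg (h i)).
- exact: emeasurable_sum.
- by move=> s; exact: sume_ge0.
Qed.

End occupancy.

(** * Hoeffding's lemma for variables in a bounded interval *)

Section hoeffding.
Context {R : realType}.

Lemma ge0_is_derive_homo (f g : R -> R) :
  (forall x : R, is_derive x (1 : R) f (g x)) -> (forall x, 0 <= x -> 0 <= g x) ->
  forall x, 0 <= x -> f 0 <= f x.
Proof.
move=> fg g0 x x0.
have df y : derivable f y 1 by case: (fg y).
apply: (@ger0_derive1_ndecr _ f 0 x) => //.
- move=> y; rewrite in_itv/= => /andP[y0 _].
  by rewrite derive1E; case: (fg y) => _ ->; rewrite g0// ltW.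
- apply: continuous_subspaceT => y.
  by apply: differentiable_continuous; apply/derivable1_diffP.
Qed.

(* The second derivative in [u] of the log-ratio of both sides is
   [1/4 - q (1 - q)] with [q = p e^u / (1 - p + p e^u)]. *)
Lemma bernoulli_mgf_le (p u : R) : 0 <= p <= 1 -> 0 <= u ->
  1 - p + p * expR u <= expR (p * u + u ^+ 2 / 8).
Proof.
move=> /andP[p0 p1] u0.
pose D (x : R) : R := 1 - p + p * expR x.
have D0 x : 0 < D x.
  have e0 := expR_gt0 x; rewrite /D.
  have [->|pn] := eqVneq p 0; first by rewrite mul0r subr0 addr0.
  have pp : 0 < p by rewrite lt_def pn.
  by rewrite ltr_wpDl ?subr_ge0// mulr_gt0.
have dD (x : R) : is_derive x (1 : R) D (p * expR x).
  have H := is_deriveD (is_derive_cst (1 - p : R^o) (x : R^o) 1)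
    (is_deriveZ p (is_derive_expR x)).
  by rewrite add0r in H; exact: H.
pose g (x : R) : R := p * x + x ^+ 2 / 8 - ln (D x).
pose g1 (x : R) : R := p + x / 4 - p * expR x / D x.
have dg (x : R) : is_derive x (1 : R) g (g1 x).
  have dlnD : is_derive x (1 : R) ((ln (R := R)) \o D) ((D x)^-1 * (p * expR x)).
    by apply: is_derive1_comp; exact: is_derive1_ln.
  have H := is_deriveB (is_deriveD (is_deriveZ p (is_derive_id (x : R^o) 1))
    (is_deriveZ 8^-1 (is_deriveM (is_derive_id (x : R^o) 1)
      (is_derive_id (x : R^o) 1)))) dlnD.
  have -> : g = ((p \*: id) + (8^-1 \*: (id * id)) - ((ln (R := R)) \o D)).
    apply/funext => y; rewrite /g.
    by rewrite -[RHS]/(p * y + 8^-1 * (y * y) - ln (D y)); field.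
  apply: (is_derive_eq H); rewrite /g1 /GRing.scale/=.
  by field; rewrite gt_eqF.
have dg1 (x : R) : is_derive x (1 : R) g1 (4^-1 - p * expR x * (1 - p) / D x ^+ 2).
  have dV := is_deriveV (lt0r_neq0 (D0 x)) (dD x).
  have H := is_deriveB (is_deriveD (is_derive_cst (p : R^o) (x : R^o) 1)
    (is_deriveZ 4^-1 (is_derive_id (x : R^o) 1)))
    (is_deriveM (is_deriveZ p (is_derive_expR x)) dV).
  have -> : g1 = (cst p + (4^-1 \*: id) - (p \*: expR) * (fun y => (D y)^-1)).
    apply/funext => y; rewrite /g1.
    by rewrite -[RHS]/(p + 4^-1 * y - p * expR y * (D y)^-1); ring.
  apply: (is_derive_eq H); rewrite /=; rewrite /GRing.scale/=.
  have := D0 x; rewrite /D => D0x.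
  by field; rewrite gt_eqF.
(* Both [g1] and [g] vanish at 0, so nonnegativity of the second derivative passes to [g1] and then
   to [g] on the half-line. *)
have g1_ge0 x : 0 <= x -> 0 <= g1 x.
  move=> x0; suff : g1 0 <= g1 x.
    by rewrite /g1 /D expR0 !(mul0r, mulr1, addr0) subrK divr1 subrr.
  apply: (ge0_is_derive_homo dg1) => // y _.
  rewrite subr_ge0 ler_pdivrMr ?exprn_gt0// ler_pdivlMl ?ltr0n//.
  (* The inequality [q (1 - q) <= 1/4], cleared of denominators: the difference of the two sides is
     a perfect square. *)
  rewrite -subr_ge0 (_ : _ - _ = (p * expR y - (1 - p)) ^+ 2) ?sqr_ge0//.
  by rewrite /D; ring.
have : 0 <= g u.
  suff : g 0 <= g u.
    by rewrite /g /D expR0 mulr0 expr0n/= mul0r addr0 mulr1 subrK ln1 subrr.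
  exact: (ge0_is_derive_homo dg).
rewrite /g subr_ge0 => le_ln.
by rewrite -[leLHS]lnK ?posrE ?D0// ler_expR.
Qed.

(** Convexity puts the exponential below its chord over [[0, V]]. The chord is affine in [x], so
    averaging it leaves the generating function of a Bernoulli variable whose parameter is the mean
    of [x / V]. *)
Lemma expR_chord (eta V x : R) : 0 < V -> 0 <= x <= V ->
  expR (eta * x) <= 1 + (expR (eta * V) - 1) / V * x.
Proof.
move=> V0 /andP[x0 xV].
have t0 : 0 <= x / V by rewrite divr_ge0// ltW.
have t1 : x / V <= 1 by rewrite ler_pdivrMr// mul1r.
have := convex_expR (Itv01 t0 t1) (eta * V) 0.
rewrite !convRE /= mulr0 addr0 expR0 mulr1 => H.
have -> : eta * x = x / V * (eta * V) by field; rewrite gt_eqF.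
apply: le_trans H _; rewrite /unstable.onem le_eqVlt; apply/orP; left; apply/eqP.
by field; rewrite gt_eqF.
Qed.

End hoeffding.

(** * Real-valued integrals over [A] against a finite weight *)

Section weighted_integral.
Context {R : realType} (m : nat) (A : set 'rV[R]_m).
Hypothesis mA : measurable (A : set (borelRV_type R m)).

(** The bounds are asked only on [A], since integrands carry the factor [\1_A]. Nonnegativity
    matches the rules for [intRm], and the upper bound keeps [wint] away from the default value of
    [fine]. *)
Definition bounded_on (g : 'rV[R]_m -> R) : Prop :=
  measurable_fun setT (g : borelRV_type R m -> R) /\
  exists M, forall a, A a -> 0 <= g a <= M.

Definition wint (w g : 'rV[R]_m -> R) : R :=
  fine (intRm (fun a => (\1_A a * w a * g a)%:E)).

Lemma bounded_onD g h : bounded_on g -> bounded_on h ->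
  bounded_on (fun a => g a + h a).
Proof.
move=> [mg [M gM]] [mh [N hN]]; split; first exact: measurable_funD.
exists (M + N) => a Aa; have /andP[? ?] := gM _ Aa; have /andP[? ?] := hN _ Aa.
by rewrite addr_ge0//= lerD.
Qed.

Lemma bounded_onM g h : bounded_on g -> bounded_on h ->
  bounded_on (fun a => g a * h a).
Proof.
move=> [mg [M gM]] [mh [N hN]]; split; first exact: measurable_funM.
exists (M * N) => a Aa; have /andP[? ?] := gM _ Aa; have /andP[? ?] := hN _ Aa.
by rewrite mulr_ge0//= ler_pM.
Qed.

Lemma bounded_on_cst c : 0 <= c -> bounded_on (fun=> c).
Proof. by move=> c0; split => //; exists c => a _; rewrite c0 lexx. Qed.

Lemma bounded_on_sum (K : nat) (h : nat -> 'rV[R]_m -> R) :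
  (forall k, bounded_on (h k)) -> bounded_on (fun a => \sum_(k < K) h k a).
Proof.
move=> hk; elim: K => [|K IH].
  rewrite (_ : (fun a => _) = fun=> 0); first exact: bounded_on_cst.
  by apply/funext => a; rewrite big_ord0.
rewrite (_ : (fun a => _) = fun a => \sum_(k < K) h k a + h K a).
  exact: bounded_onD.
by apply/funext => a; rewrite big_ord_recr.
Qed.

Lemma bounded_on_expR (g : 'rV[R]_m -> R) c : 0 <= c -> bounded_on g ->
  bounded_on (fun a => expR (c * g a)).
Proof.
move=> c0 [mg [M gM]]; split.
  by apply: measurableT_comp => //; exact: measurable_funM.
exists (expR (c * M)) => a Aa; have /andP[? ?] := gM _ Aa.
by rewrite expR_ge0/= ler_expR ler_wpM2l.
Qed.

Variable w : 'rV[R]_m -> R.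
Hypothesis mw : measurable_fun setT (w : borelRV_type R m -> R).
Hypothesis w0 : forall a, 0 <= w a.
Hypothesis w_fin : (intRm (fun a => (\1_A a * w a)%:E) < +oo)%E.

Let measurable_term g : bounded_on g ->
  measurable_fun setT (fun a : borelRV_type R m => (\1_A a * w a * g a)%:E).
Proof.
move=> [mg _]; apply/measurable_EFinP.
by apply: measurable_funM => //; apply: measurable_funM => //; exact: measurable_indic.
Qed.

Let term_ge0 g a : bounded_on g -> (0 <= (\1_A a * w a * g a)%:E)%E.
Proof.
move=> [_ [M gM]]; rewrite lee_fin indicE; case: (boolP (a \in A)) => aA.
  by rewrite mul1r mulr_ge0//; rewrite inE in aA; have /andP[] := gM _ aA.
by rewrite !mul0r.
Qed.

Lemma wintE g : bounded_on g ->
  intRm (fun a => (\1_A a * w a * g a)%:E) = (wint w g)%:E.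
Proof.
move=> bg; rewrite /wint fineK// ge0_fin_numE; last first.
  by apply: intRm_ge0 => a; exact: term_ge0.
have [_ [M gM]] := bg.
(* If [A] is empty, [M] may be negative. *)
pose M' := Num.max M 0.
have M0 : 0 <= M' by rewrite le_max lexx orbT.
have mw1 : measurable_fun setT (fun a : borelRV_type R m => (\1_A a * w a)%:E).
  by apply/measurable_EFinP; apply: measurable_funM => //; exact: measurable_indic.
have w10 a : (0 <= (\1_A a * w a)%:E)%E by rewrite lee_fin mulr_ge0.
apply: (@le_lt_trans _ _ (intRm (fun a => M'%:E * (\1_A a * w a)%:E)%E)).
  apply: le_intRm => //.
  - exact: measurable_term.
  - exact: measurable_funeM.
  - by move=> a; exact: term_ge0.
  - move=> a; rewrite -EFinM lee_fin indicE; case: (boolP (a \in A)) => aA.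
      rewrite !mul1r mulrC ler_wpM2r//; rewrite inE in aA.
      by have /andP[_ ?] := gM _ aA; rewrite le_max; apply/orP; left.
    by rewrite !mul0r mulr0.
rewrite intRmZl// lte_mul_pinfty//.
Qed.

Lemma le_wint g h : bounded_on g -> bounded_on h ->
  (forall a, A a -> g a <= h a) -> wint w g <= wint w h.
Proof.
move=> bg bh gh; rewrite -lee_fin -!wintE//.
apply: le_intRm.
- exact: measurable_term.
- exact: measurable_term.
- by move=> a; exact: term_ge0.
- move=> a; rewrite lee_fin indicE; case: (boolP (a \in A)) => aA.
    by rewrite mul1r ler_wpM2l//; apply: gh; rewrite inE in aA.
  by rewrite !mul0r.
Qed.

Lemma eq_wint g h : (forall a, A a -> g a = h a) -> wint w g = wint w h.
Proof.
move=> gh; congr fine; apply: eq_intRm => a; congr EFin.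
rewrite indicE; case: (boolP (a \in A)) => aA; last by rewrite !mul0r.
by rewrite inE in aA; rewrite gh.
Qed.

Lemma wint_ge0 g : bounded_on g -> 0 <= wint w g.
Proof.
by move=> bg; rewrite -lee_fin -wintE//; apply: intRm_ge0 => a; exact: term_ge0.
Qed.

Lemma wintD g h : bounded_on g -> bounded_on h ->
  wint w (fun a => g a + h a) = wint w g + wint w h.
Proof.
move=> bg bh; apply: EFin_inj; rewrite EFinD -!wintE//; last exact: bounded_onD.
rewrite -intRmD//.
- by apply: eq_intRm => a; rewrite -EFinD mulrDr.
- exact: measurable_term.
- exact: measurable_term.
- by move=> a; exact: term_ge0.
- by move=> a; exact: term_ge0.
Qed.

Lemma wintZ c g : 0 <= c -> bounded_on g ->
  wint w (fun a => c * g a) = c * wint w g.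
Proof.
move=> c0 bg; apply: EFin_inj; rewrite EFinM -!wintE//; last first.
  by apply: bounded_onM => //; exact: bounded_on_cst.
rewrite -intRmZl//.
- by apply: eq_intRm => a; rewrite -EFinM mulrCA.
- exact: measurable_term.
- by move=> a; exact: term_ge0.
Qed.

Lemma wint_sum (K : nat) (h : nat -> 'rV[R]_m -> R) :
  (forall k, bounded_on (h k)) ->
  wint w (fun a => \sum_(k < K) h k a) = \sum_(k < K) wint w (h k).
Proof.
move=> hk; elim: K => [|K IH].
  rewrite big_ord0 -[RHS](mul0r (wint w (fun=> 0))) -wintZ//.
    by apply: eq_wint => a _; rewrite big_ord0 mul0r.
  exact: bounded_on_cst.
rewrite big_ord_recr/= -IH -wintD//; last exact: bounded_on_sum.
by apply: eq_wint => a _; rewrite big_ord_recr.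
Qed.

End weighted_integral.

(** * Exponential weights at a fixed state *)

Section hedge.
Context {R : realType} (m : nat) (A : set 'rV[R]_m) (eta V : R).
Variable F : nat -> 'rV[R]_m -> R.
Hypothesis mA : measurable (A : set (borelRV_type R m)).
Hypothesis nuA_gt0 : (0 < nu A)%E.
Hypothesis nuA_fin : (nu A < +oo)%E.
Hypothesis eta0 : 0 <= eta.
Hypothesis mF : forall k, measurable_fun setT (F k : borelRV_type R m -> R).
Hypothesis FV : forall k a, A a -> 0 <= F k a <= V.

(** The unnormalized weight after [k] critic outputs. Indices start at 0, so on [A] it is
    proportional to the density of [pspi k], that is of [pi_(k+1)]. *)
Definition Phi (k : nat) (a : 'rV[R]_m) : R := expR (eta * \sum_(j < k) F j a).

Definition partition_fun (k : nat) : R := wint A (cst 1) (Phi k).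

Definition hedge_avg (k : nat) : R :=
  wint A (cst 1) (fun a => Phi k a * F k a) / partition_fun k.

Local Notation W := partition_fun.
Local Notation X := hedge_avg.
Local Notation I := (wint A (cst 1)).

Let one_ge0 (a : 'rV[R]_m) : (0 : R) <= cst 1 a. Proof. by []. Qed.

Let one_meas : measurable_fun setT (cst 1 : borelRV_type R m -> R).
Proof. by []. Qed.

Let one_fin : (intRm (fun a => (\1_A a * cst (1 : R) a)%:E) < +oo)%E.
Proof. by under eq_intRm do rewrite mulr1. Qed.

Let bF k : bounded_on A (F k).
Proof. by split; [exact: mF|exists V => a; exact: FV]. Qed.

Let bPhi k : bounded_on A (Phi k).
Proof. by apply: bounded_on_expR => //; exact: bounded_on_sum. Qed.

Let bPhiF k : bounded_on A (fun a => Phi k a * F k a).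
Proof. exact: bounded_onM. Qed.

Lemma Phi_gt0 k a : 0 < Phi k a. Proof. exact: expR_gt0. Qed.

Lemma PhiS k a : Phi k.+1 a = Phi k a * expR (eta * F k a).
Proof. by rewrite /Phi big_ord_recr/= mulrDr expRD. Qed.

Lemma Phi0 a : Phi 0 a = 1.
Proof. by rewrite /Phi big_ord0 mulr0 expR0. Qed.

Lemma partition_fun0 : W 0 = fine (nu A).
Proof.
by rewrite /W /wint /nu; congr fine; apply: eq_intRm => a; rewrite Phi0 !mulr1.
Qed.

Lemma partition_fun0_gt0 : 0 < W 0.
Proof. by rewrite partition_fun0 fine_gt0// nuA_gt0. Qed.

Lemma partition_fun_gt0 k : 0 < W k.
Proof.
apply: lt_le_trans partition_fun0_gt0 _; apply: le_wint => // a Aa.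
rewrite Phi0 -expR0 ler_expR mulr_ge0// sumr_ge0// => j _.
by have /andP[] := FV j Aa.
Qed.

Local Notation W_gt0 := partition_fun_gt0.
Local Hint Extern 0 (is_true (0 < partition_fun _)) => exact: partition_fun_gt0 : core.

Lemma hedge_avg_ge0 k : 0 <= X k.
Proof. by rewrite divr_ge0 ?wint_ge0// ltW. Qed.

Lemma hedge_avgE k : I (fun a => Phi k a * F k a) = X k * W k.
Proof. by rewrite /X divfK// gt_eqF. Qed.

Lemma hedge_avg_le k : X k <= V.
Proof.
have [a Aa] := nu_gt0_nonempty nuA_gt0.
have V0 : 0 <= V by have /andP[] := FV 0 Aa; exact: le_trans.
rewrite /X ler_pdivrMr// -wintZ//.
apply: le_wint => //.
  by apply: bounded_onM => //; exact: bounded_on_cst.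
move=> b Ab; rewrite mulrC ler_wpM2r ?(ltW (Phi_gt0 _ _))//.
by have /andP[] := FV k Ab.
Qed.

(** Serves the degenerate cases of the tuned bound: [D] is 0 when [A] is a single point, and [L * B]
    when there is one iteration. *)
Lemma hedge_avg_ge k (c D : R) : 0 <= D -> 0 <= c ->
  (forall b, A b -> c <= F k b + D) -> c <= X k + D.
Proof.
move=> D0 c0 cF.
have : c * W k <= (X k + D) * W k.
  rewrite mulrDl -hedge_avgE -!wintZ// -wintD//; last first.
    by apply: bounded_onM => //; exact: bounded_on_cst.
  apply: le_wint => //.
  - by apply: bounded_onM => //; exact: bounded_on_cst.
  - by apply: bounded_onD => //; apply: bounded_onM => //; exact: bounded_on_cst.
  - move=> b Ab; rewrite [Phi k b * _]mulrC -mulrDl ler_wpM2r ?cF//.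
    exact/ltW/Phi_gt0.
by rewrite ler_pM2r.
Qed.

(** Integrating the chord bound against [Phi k] gives [W k * (1 - q + q * expR (eta * V))] with
    [q = X k / V], to which the Bernoulli bound applies with [u = eta * V]. *)
Lemma hedge_step k : 0 < V ->
  W k.+1 <= W k * expR (eta * X k + (eta * V) ^+ 2 / 8).
Proof.
move=> V0; pose c := (expR (eta * V) - 1) / V.
have c0 : 0 <= c.
  by rewrite divr_ge0 ?(ltW V0)// subr_ge0 -expR0 ler_expR mulr_ge0// ltW.
have bc : bounded_on A (fun a => c * (Phi k a * F k a)).
  by apply: bounded_onM => //; exact: bounded_on_cst.
apply: (@le_trans _ _ (W k + c * (X k * W k))).
  rewrite -hedge_avgE -wintZ// -wintD//.
  apply: le_wint => //; first exact: bounded_onD.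
  move=> a Aa; rewrite PhiS.
  have -> : Phi k a + c * (Phi k a * F k a) = Phi k a * (1 + c * F k a) by ring.
  by rewrite ler_wpM2l ?(ltW (Phi_gt0 _ _))//; apply: expR_chord => //; exact: FV.
have -> : W k + c * (X k * W k) =
    W k * (1 - X k / V + X k / V * expR (eta * V)).
  by rewrite /c; field; rewrite gt_eqF.
rewrite ler_wpM2l ?(ltW (W_gt0 k))//.
have -> : eta * X k = X k / V * (eta * V) by field; rewrite gt_eqF.
apply: bernoulli_mgf_le; last by rewrite mulr_ge0// ltW.
by rewrite divr_ge0 ?hedge_avg_ge0 ?(ltW V0)//= ler_pdivrMr// mul1r hedge_avg_le.
Qed.

Lemma hedge_upper n : 0 < V ->
  W n <= W 0 * expR (eta * \sum_(k < n) X k + n%:R * ((eta * V) ^+ 2 / 8)).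
Proof.
move=> V0; elim: n => [|n IH].
  by rewrite big_ord0 mulr0 mul0r addr0 expR0 mulr1.
apply: le_trans (hedge_step n V0) _.
apply: le_trans (ler_wpM2r (expR_ge0 _) IH) _.
rewrite -mulrA -expRD big_ord_recr/= -natr1 le_eqVlt; apply/orP; left; apply/eqP.
by congr (_ * expR _); ring.
Qed.

(* Shrinking [A] by the factor [e] towards [a] keeps it inside [A] and scales its
   volume by [e ^+ m]. *)
Lemma hedge_lower n (a : 'rV[R]_m) (e delta : R) : 0 < e ->
  (forall b, A b -> A ((1 - e) *: a + e *: b)) ->
  (forall j b, A b -> F j a - delta <= F j ((1 - e) *: a + e *: b)) ->
  e ^+ m * expR (eta * (\sum_(j < n) F j a - n%:R * delta)) * W 0 <= W n.
Proof.
move=> e0 Ae Fe; set c := expR _.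
have c0 : 0 <= c by exact: expR_ge0.
have em0 : 0 <= e ^+ m by rewrite exprn_ge0// ltW.
rewrite -mulrA -(wintZ mA one_meas one_ge0 one_fin c0 (bPhi 0)).
have bc : bounded_on A (fun a => c * Phi 0 a).
  by apply: bounded_onM => //; exact: bounded_on_cst.
rewrite -lee_fin EFinM -!wintE//.
pose g (v : borelRV_type R m) : \bar R := (\1_A v * cst 1 v * Phi n v)%:E.
have mg : measurable_fun setT g.
  apply/measurable_EFinP; apply: measurable_funM; last by have [] := bPhi n.
  by apply: measurable_funM => //; exact: measurable_indic.
have g0 v : (0 <= g v)%E by rewrite lee_fin !mulr_ge0// ltW// Phi_gt0.
(* Substituting the contraction towards [a] in [W n] produces the factor [e ^+ m] on the right as
   well, and the integrands can then be compared pointwise. *)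
rewrite -[leRHS](intRm_affine ((1 - e) *: a) e0 mg g0).
apply: lee_wpmul2l; first by rewrite lee_fin.
have maff : measurable_fun setT (fun v : borelRV_type R m =>
    ((1 - e) *: a + e *: (v : 'rV[R]_m)) : borelRV_type R m).
  apply: measurable_rV => i.
  rewrite (_ : (fun t => _) =
    (fun v : borelRV_type R m => ((1 - e) *: a) ord0 i + e * (v : 'rV[R]_m) ord0 i)).
    apply: measurable_funD => //; apply: measurable_funM => //.
    exact: measurable_coord.
  by apply/funext => t; rewrite !mxE.
apply: le_intRm.
- apply/measurable_EFinP; apply: measurable_funM; last by have [] := bc.
  by apply: measurable_funM => //; exact: measurable_indic.
- exact: (measurableT_comp mg maff).
- by move=> v; rewrite lee_fin !mulr_ge0// ltW// Phi_gt0.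
- move=> v; rewrite /g lee_fin [\1_A v]indicE.
  case: (boolP (v \in A)) => Av; last first.
    by rewrite !mul0r !mulr_ge0// ltW// Phi_gt0.
  rewrite inE in Av.
  rewrite indicE mem_set; last exact: Ae.
  rewrite !mul1r Phi0 mulr1 ler_expR ler_wpM2l//.
  apply: (@le_trans _ _ (\sum_(j < n) (F j a - delta))).
    by rewrite big_split/= sumr_const card_ord mulNrn mulr_natl.
  by apply: ler_sum => j _; exact: Fe.
Qed.

(** The lower and upper bounds on [W n] share the positive factor [W 0]; cancelling it and taking
    logarithms turns the volume ratio [e ^+ m] into [m ln e]. *)
Lemma hedge_regret n (a : 'rV[R]_m) (e delta : R) : 0 < V -> 0 < e ->
  (forall b, A b -> A ((1 - e) *: a + e *: b)) ->
  (forall j b, A b -> F j a - delta <= F j ((1 - e) *: a + e *: b)) ->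
  eta * (\sum_(j < n) F j a - n%:R * delta - \sum_(k < n) X k) <=
    - (m%:R * ln e) + n%:R * ((eta * V) ^+ 2 / 8).
Proof.
move=> V0 e0 Ae Fe.
have := le_trans (hedge_lower n e0 Ae Fe) (hedge_upper n V0).
rewrite [leLHS]mulrC ler_pM2l ?partition_fun0_gt0//.
rewrite -{1}(lnK (x := e)) ?posrE// -expRM_natl -expRD ler_expR.
by lra.
Qed.

End hedge.

(** * PSPI policies in closed form *)

Section pspi_theory.
Context {R : realType} d (S : measurableType d) (m : nat) (A : set 'rV[R]_m).
Variables (eta V : R) (f : nat -> S -> 'rV[R]_m -> R).
Hypothesis mA : measurable (A : set (borelRV_type R m)).
Hypothesis nuA_gt0 : (0 < nu A)%E.
Hypothesis nuA_fin : (nu A < +oo)%E.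
Hypothesis eta0 : 0 <= eta.
Hypothesis mf : forall k, jmeasurable (f k).
Hypothesis fV : forall k s a, A a -> 0 <= f k s a <= V.

Local Notation ff s := (fun k => f k s).
Local Notation W s k := (partition_fun A eta (ff s) k).

Lemma jmeasurable_section (g : S -> 'rV[R]_m -> R) s : jmeasurable g ->
  measurable_fun setT (g s : borelRV_type R m -> R).
Proof. by move=> /jmeasurable_fun mg; exact: (measurable_fun_pair2 s mg). Qed.

Let mF s k : measurable_fun setT (ff s k : borelRV_type R m -> R).
Proof. exact: jmeasurable_section. Qed.

Let FV s k a : A a -> 0 <= ff s k a <= V.
Proof. exact: fV. Qed.

Let one_fin : (intRm (fun a => (\1_A a * cst (1 : R) a)%:E) < +oo)%E.
Proof. by under eq_intRm do rewrite mulr1. Qed.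

Let W_gt0 s k : 0 < W s k.
Proof. exact: (partition_fun_gt0 mA nuA_gt0 nuA_fin eta0 (mF s) (@FV s)). Qed.

Let bf s k : bounded_on A (f k s).
Proof. by split; [exact: mF|exists V => a; exact: fV]. Qed.

Let bPhi s k : bounded_on A (Phi eta (ff s) k).
Proof. by apply: bounded_on_expR => //; exact: (bounded_on_sum k (bf s)). Qed.

(** The normalizer of update [k] is [W s k.+1 / W s k], so the normalizers telescope and only the
    last one remains. *)
Lemma pspiE k s a :
  pspi A eta f k s a = \1_A a * Phi eta (ff s) k a / W s k.
Proof.
elim: k s a => [|k IH] s a /=.
  by rewrite Phi0 mulr1 partition_fun0.
set Z := fine _.
have -> : Z = (W s k)^-1 * W s k.+1.
  rewrite -(wintZ mA _ _ one_fin) ?invr_ge0 ?(ltW (W_gt0 _ _))//.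
  rewrite /Z /wint; congr fine; apply: eq_intRm => b; rewrite IH PhiS /cst.
  congr EFin; rewrite indicE; case: (b \in A); rewrite ?mul0r// !mul1r.
  by rewrite mulrC [in RHS]mulrCA mulrA; ring.
rewrite IH PhiS; have := W_gt0 s k; have := W_gt0 s k.+1 => W1 W2.
by field; rewrite !gt_eqF.
Qed.

Lemma fpol_pspi k s :
  fpol A (f k) (pspi A eta f k) s = (hedge_avg A eta (ff s) k)%:E.
Proof.
have bg : bounded_on A (fun a => Phi eta (ff s) k a * f k s a) by exact: bounded_onM.
rewrite /hedge_avg mulrC -(wintZ mA _ _ one_fin) ?invr_ge0 ?(ltW (W_gt0 _ _))//.
rewrite -wintE//; last first.
  by apply: bounded_onM => //; apply: bounded_on_cst; rewrite invr_ge0 ltW.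
apply: eq_intRm => a; rewrite pspiE /cst; congr EFin.
by rewrite indicE; case: (a \in A); rewrite ?mul0r// !mul1r; ring.
Qed.

Lemma fpol_wint (pi : S -> 'rV[R]_m -> R) k s : is_policy A pi ->
  fpol A (f k) pi s = (wint A (pi s) (f k s))%:E.
Proof.
move=> [mpi [pi0 pi1]]; apply: wintE => //.
  exact: jmeasurable_section.
by rewrite pi1 ltry.
Qed.

Lemma measurable_fpol (pi : S -> 'rV[R]_m -> R) k :
  measurable_fun setT (fun p : S * borelRV_type R m => pi p.1 p.2) ->
  (forall s a, 0 <= pi s a) ->
  measurable_fun setT (fpol A (f k) pi).
Proof.
move=> mpi pi0.
apply: (@measurable_intRm _ _ _ m (fun p : S * borelRV_type R m =>
  (\1_A p.2 * pi p.1 p.2 * f k p.1 p.2)%:E)).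
  apply/measurable_EFinP; apply: measurable_funM; last exact: jmeasurable_fun.
  apply: measurable_funM => //.
  exact: (measurableT_comp (f := \1_A : borelRV_type R m -> R)).
move=> [s a]/=; rewrite lee_fin indicE; case: (boolP (a \in A)) => aA.
  by rewrite mul1r mulr_ge0//; rewrite inE in aA; have /andP[] := fV k s aA.
by rewrite !mul0r.
Qed.

Let measurable_Phi k :
  measurable_fun setT (fun p : S * borelRV_type R m => Phi eta (ff p.1) k p.2).
Proof.
apply: measurableT_comp => //; apply: measurable_funM => //.
by apply: measurable_sum => j; exact: jmeasurable_fun.
Qed.

Let measurable_W k : measurable_fun setT (fun s => W s k).
Proof.
apply: (measurableT_comp (fine_measurable _)) => //.
apply: (@measurable_intRm _ _ _ m (fun p : S * borelRV_type R m =>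
  (\1_A p.2 * cst 1 p.2 * Phi eta (ff p.1) k p.2)%:E)).
  apply/measurable_EFinP; apply: measurable_funM => //.
  apply: measurable_funM => //.
  exact: (measurableT_comp (f := \1_A : borelRV_type R m -> R)).
by move=> p; rewrite lee_fin !mulr_ge0// ltW// Phi_gt0.
Qed.

Lemma pspi_ge0 k s a : 0 <= pspi A eta f k s a.
Proof. by rewrite pspiE divr_ge0 ?mulr_ge0 ?(ltW (W_gt0 _ _))// ltW// Phi_gt0. Qed.

Lemma measurable_pspi k :
  measurable_fun setT (fun p : S * borelRV_type R m => pspi A eta f k p.1 p.2).
Proof.
(* Since [W] is positive, its inverse is [expR (- ln W)], a composition of measurable maps. *)
rewrite (_ : (fun p => _) = (fun p : S * borelRV_type R m =>
    \1_A p.2 * Phi eta (ff p.1) k p.2 * expR (- ln (W p.1 k)))); last first.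
  by apply/funext => p; rewrite pspiE expRN lnK// posrE W_gt0.
apply: measurable_funM.
  apply: measurable_funM => //.
  exact: (measurableT_comp (f := \1_A : borelRV_type R m -> R)).
have mW : measurable_fun setT (fun p : S * borelRV_type R m => W p.1 k).
  exact: (measurableT_comp (measurable_W k) measurable_fst).
have mlnW := measurableT_comp (@measurable_ln R) mW.
exact: (measurableT_comp (@measurable_expR R)
  (measurableT_comp (@oppr_measurable R setT) mlnW)).
Qed.

End pspi_theory.

(** * Euclidean norm, diameter and convexity *)

Section geometry.
Context {R : realType} (m : nat).

Lemma euclid_ge0 (v : 'rV[R]_m) : 0 <= euclid v.
Proof. exact: sqrtr_ge0. Qed.

Lemma euclid0 : euclid (0 : 'rV[R]_m) = 0.
Proof.
by rewrite /euclid big1 ?sqrtr0// => i _; rewrite mxE expr0n.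
Qed.

Lemma euclidZ (e : R) (v : 'rV[R]_m) : 0 <= e -> euclid (e *: v) = e * euclid v.
Proof.
move=> e0; rewrite /euclid.
under eq_bigr do rewrite mxE exprMn.
by rewrite -mulr_sumr sqrtrM ?sqr_ge0// sqrtr_sqr ger0_norm.
Qed.

Lemma euclid_le_diam (A : set 'rV[R]_m) (B : R) a b :
  diam A = B%:E -> A a -> A b -> euclid (a - b) <= B.
Proof.
move=> dA Aa Ab; rewrite -lee_fin -dA; apply: ereal_sup_ubound.
by exists a, b.
Qed.

(* For [L < 0] the Lipschitz bound forces the diameter to be zero. *)
Lemma lipschitz_le_diam (A : set 'rV[R]_m) (B L : R) (g : 'rV[R]_m -> R) :
  diam A = B%:E ->
  (forall a b, A a -> A b -> `|g a - g b| <= L * euclid (a - b)) ->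
  forall a b, A a -> A b -> L * euclid (a - b) <= L * B.
Proof.
move=> dA gL a b Aa Ab.
have [L0|L0] := leP 0 L; first by rewrite ler_wpM2l// (euclid_le_diam dA).
have e0 x y : A x -> A y -> euclid (x - y) = 0.
  move=> Ax Ay; apply/eqP; rewrite eq_le euclid_ge0 andbT.
  by have := le_trans (normr_ge0 _) (gL x y Ax Ay); rewrite nmulr_rge0.
suff : B <= 0 by move=> B0; rewrite e0// mulr0 nmulr_rge0.
rewrite -lee_fin -dA; apply: ge_ereal_sup => _ [x [y [Ax [Ay ->]]]].
by rewrite lee_fin e0.
Qed.

Lemma convex_setP (A : set 'rV[R]_m) (x y : 'rV[R]_m) (t : R) :
  convex_set A -> 0 <= t <= 1 -> A x -> A y -> A ((1 - t) *: x + t *: y).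
Proof.
move=> cA /andP[t0 t1] Ax Ay.
have s0 : 0 <= 1 - t by rewrite subr_ge0.
have s1 : 1 - t <= 1 by rewrite gerBl.
have := cA x y (Itv01 s0 s1) (mem_set Ax) (mem_set Ay).
by rewrite inE /conv /= /unstable.onem opprB addrCA subrr addr0.
Qed.

End geometry.

(** * Choice of the parameters and integration over actions and states *)

Lemma hedge_regret_tuned (R : realType) (m : nat) (A : set 'rV[R]_m) (V B L eta : R)
  (F : nat -> 'rV[R]_m -> R) (K : nat) (a : 'rV[R]_m) :
  measurable (A : set (borelRV_type R m)) ->
  (0 < nu A)%E -> (nu A < +oo)%E -> convex_set A -> diam A = B%:E ->
  (forall k, measurable_fun setT (F k : borelRV_type R m -> R)) ->
  (forall k a, A a -> 0 <= F k a <= V) ->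
  (forall k a b, A a -> A b -> `|F k a - F k b| <= L * euclid (a - b)) ->
  (0 < K)%N -> A a ->
  eta = Num.sqrt (8 * m%:R * ln K%:R / (K%:R * V ^+ 2)) ->
  \sum_(k < K) F k a <= \sum_(k < K) hedge_avg A eta F k +
    (V * Num.sqrt (m%:R * ln K%:R / (2 * K%:R)) + L * B / K%:R) * K%:R.
Proof.
move=> mA nu0 nu1 cA dA mF FV FL K0 Aa etaE.
have eta0 : 0 <= eta by rewrite etaE sqrtr_ge0.
have lnK0 : 0 <= ln (K%:R : R) by rewrite ln_ge0// ler1n.
have KR0 : 0 < K%:R :> R by rewrite ltr0n.
have LB b c : A b -> A c -> L * euclid (b - c) <= L * B.
  exact: (lipschitz_le_diam dA (FL 0)).
have LB0 : 0 <= L * B by rewrite -[leLHS](mulr0 L) -(@euclid0 R m) -(subrr a) LB.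
have V0 : 0 <= V by have /andP[] := FV 0 _ Aa; exact: le_trans.
have X0 k : 0 <= hedge_avg A eta F k.
  exact: (hedge_avg_ge0 mA nu1 eta0 mF FV).
set q := Num.sqrt (m%:R * ln K%:R / (2 * K%:R)).
have q0 : 0 <= q by exact: sqrtr_ge0.
have -> : (V * q + L * B / K%:R) * K%:R = V * q * K%:R + L * B.
  by field; rewrite gt_eqF.
have Vq0 : 0 <= V * q * K%:R by rewrite !mulr_ge0.
(* If [V] is 0, every [F k a] vanishes and the right side is nonnegative. *)
have [V_eq0|V_neq0] := eqVneq V 0.
  rewrite big1 ?addr_ge0 ?sumr_ge0// => k _.
  by apply/eqP; rewrite eq_le; have := FV k _ Aa; rewrite V_eq0 andbC.
have Vp : 0 < V by rewrite lt_def V_neq0.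
(* In dimension zero [A] is a single point, so each average dominates the value at [a]. *)
have [m0|m_gt0] := posnP m.
  apply: (@le_trans _ _ (\sum_(k < K) hedge_avg A eta F k)); last first.
    by rewrite lerDl addr_ge0.
  apply: ler_sum => k _; rewrite -[leRHS]addr0.
  apply: (hedge_avg_ge mA nu0 nu1 eta0 mF FV) => //.
    by have /andP[] := FV k _ Aa.
  move=> b Ab; rewrite addr0 (_ : a = b)//.
  by apply/matrixP => i [j jm]; exfalso; rewrite m0 in jm.
(* For one iteration the term [L * B / K] is all of [L * B], which the Lipschitz bound yields
   directly. *)
have [K1|K_neq1] := eqVneq K 1%N.
  move: Vq0; rewrite K1 !big_ord1 => Vq0.
  apply: (@le_trans _ _ (hedge_avg A eta F 0 + L * B)).
    apply: (hedge_avg_ge mA nu0 nu1 eta0 mF FV) => //.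
      by have /andP[] := FV 0 _ Aa.
    move=> b Ab; rewrite -lerBlDl; apply: le_trans (LB a b Aa Ab).
    by apply: le_trans (FL 0 a b Aa Ab); exact: ler_norm.
  by rewrite lerD2l lerDr.
have K_gt1 : (1 < K)%N by rewrite ltn_neqAle eq_sym K_neq1.
have lnKp : 0 < ln (K%:R : R) by rewrite ln_gt0// ltr1n.
have mp : 0 < m%:R :> R by rewrite ltr0n.
have etap : 0 < eta by rewrite etaE sqrtr_gt0 !(divr_gt0, mulr_gt0, exprn_gt0).
have eta_sq : eta ^+ 2 = 8 * m%:R * ln K%:R / (K%:R * V ^+ 2).
  by rewrite etaE sqr_sqrtr// !(divr_ge0, mulr_ge0, exprn_ge0).
(* Both sides are nonnegative with square [8 m ln K / K]. *)
have etaV : eta * V = 4 * q.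
  rewrite -[eta]ger0_norm// -[q]ger0_norm//.
  apply/eqP; rewrite -(@eqrXn2 _ 2) ?mulr_ge0//; apply/eqP.
  rewrite !ger0_norm// !exprMn eta_sq /q sqr_sqrtr ?divr_ge0 ?mulr_ge0//.
  by field; rewrite V_neq0 gt_eqF.
(* Shrinking by [1 / K] costs [m ln K] in volume, while the Lipschitz loss over [K] rounds totals
   only [L * B]. *)
pose e : R := K%:R^-1.
have e0 : 0 < e by rewrite invr_gt0.
have e1 : e <= 1 by rewrite invf_le1// ler1n.
have Ae b : A b -> A ((1 - e) *: a + e *: b).
  by move=> Ab; apply: convex_setP => //; rewrite (ltW e0).
have Fe j b : A b -> F j a - e * (L * B) <= F j ((1 - e) *: a + e *: b).
  move=> Ab; rewrite lerBlDl -lerBlDr.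
  apply: le_trans (ler_norm _) _; apply: le_trans (FL j _ _ Aa (Ae _ Ab)) _.
  have -> : a - ((1 - e) *: a + e *: b) = e *: (a - b).
    by rewrite scalerBr scalerBl scale1r opprD opprB addrA addrCA subrr addr0.
  by rewrite euclidZ ?(ltW e0)// mulrCA ler_wpM2l ?(ltW e0)// LB.
have := hedge_regret mA nu0 nu1 eta0 mF FV K Vp e0 Ae Fe.
rewrite lnV ?posrE// (mulrA K%:R) mulfV ?gt_eqF// mul1r mulrN opprK.
(* The step size balances the volume cost and the Hoeffding cost; their sum is [eta * (V * q * K)],
   and dividing by [eta] leaves the stated rate. *)
have -> : m%:R * ln K%:R = K%:R * ((eta * V) ^+ 2 / 8) :> R.
  by rewrite exprMn eta_sq; field; rewrite V_neq0 gt_eqF.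
have -> : K%:R * ((eta * V) ^+ 2 / 8) + K%:R * ((eta * V) ^+ 2 / 8) =
    eta * (V * (eta * V / 4) * K%:R) by field.
rewrite etaV ler_pM2l// (_ : 4 * q / 4 = q); last by field.
by lra.
Qed.

Lemma wint_policy_le (R : realType) d (S : measurableType d) (m : nat)
  (A : set 'rV[R]_m) (pi : S -> 'rV[R]_m -> R) s (g : 'rV[R]_m -> R) (c : R) :
  measurable (A : set (borelRV_type R m)) -> is_policy A pi ->
  bounded_on A g -> 0 <= c -> (forall a, A a -> g a <= c) ->
  wint A (pi s) g <= c.
Proof.
move=> mA [mpi [pi0 pi1]] bg c0 gc.
have mpis : measurable_fun setT (pi s : borelRV_type R m -> R).
  exact: jmeasurable_section.
have pi_fin : (intRm (fun a => (\1_A a * pi s a)%:E) < +oo)%E by rewrite pi1 ltry.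
have wint1 : wint A (pi s) (fun=> 1) = 1.
  by rewrite /wint; under eq_intRm do rewrite mulr1; rewrite pi1.
have -> : c = wint A (pi s) (fun a => c * 1).
  by rewrite wintZ ?wint1 ?mulr1//; exact: bounded_on_cst.
apply: le_wint => //.
- by apply: bounded_on_cst; rewrite mulr1.
- by move=> a Aa; rewrite mulr1 gc.
Qed.

Unset Implicit Arguments.
Set Strict Implicit.

Theorem theoremB1 (R : realType) (d : measure_display) (S : measurableType d)
  (m : nat)
  (* MDP: initial distribution, transition kernel, reward, discount *)
  (mu0 : probability S R) (P : S -> 'rV[R]_m -> probability S R)
  (r : S -> 'rV[R]_m -> R) (Rmax gamma : R)
  (* action set A ⊂ R^m *)
  (A : set 'rV[R]_m) (B L : R)
  (* critic class and outputs, comparator, number of iterations *)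
  (F : set (S -> 'rV[R]_m -> R)) (f : nat -> S -> 'rV[R]_m -> R)
  (picp : S -> 'rV[R]_m -> R) (K : nat) :
  0 <= gamma < 1 ->
  (forall X, measurable X -> jmeasurable (fun s a => fine (P s a X))) ->
  (forall s a, A a -> 0 <= r s a <= Rmax) ->
  convex_set A -> compact A ->
  diam A = B%:E ->
  (0 < nu A)%E -> (nu A < +oo)%E ->
  (forall g, F g -> jmeasurable g /\
     (forall s a, A a -> 0 <= g s a <= Rmax / (1 - gamma))) ->
  (forall k, F (f k)) ->
  (forall k s a b, A a -> A b -> `|f k s a - f k s b| <= L * euclid (a - b)) ->
  is_policy A picp ->
  (0 < K)%N ->
  let Vmax := Rmax / (1 - gamma) in
  let eta := Num.sqrt (8 * m%:R * ln K%:R / (K%:R * Vmax ^+ 2)) in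
  (regret A mu0 P gamma eta f picp K * (K%:R^-1)%:E <=
    (Vmax * Num.sqrt (m%:R * ln K%:R / (2 * K%:R)) + L * B / K%:R)%:E)%E.
Proof.
move=> gamma01 mP _ cA kA dA nu0 nu1 FF Ff fL pol K0; cbv zeta.
set Vmax := Rmax / (1 - gamma).
set eta := Num.sqrt (8 * m%:R * ln K%:R / (K%:R * Vmax ^+ 2)).
have mA := compact_measurable_rV kA.
have [a0 Aa0] := nu_gt0_nonempty nu0.
have mf k : jmeasurable (f k) by have [] := FF _ (Ff k).
have fV k s a : A a -> 0 <= f k s a <= Vmax.
  by have [_ +] := FF _ (Ff k); exact.
(* The state space carries the probability [mu0], hence is nonempty. A state together with a point
   of [A] gives the signs of [Vmax] and [L * B]. *)
have [s0] : exists s : S, True.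
  have [//|nS] := pselect (exists s : S, True).
  have : mu0 setT = 1%E by exact: probability_setT.
  rewrite (_ : setT = set0) ?measure0; first by move=> [] /esym/eqP; rewrite oner_eq0.
  by apply/seteqP; split => // s _; apply: nS; exists s.
move=> _.
have V0 : 0 <= Vmax by have /andP[] := fV 0%N s0 _ Aa0; exact: le_trans.
have eta0 : 0 <= eta by exact: sqrtr_ge0.
have KR0 : 0 < K%:R :> R by rewrite ltr0n.
have LB0 : 0 <= L * B.
  rewrite -[leLHS](mulr0 L) -(@euclid0 R m) -(subrr a0).
  exact: (lipschitz_le_diam dA (fL 0%N s0)).
set C := (X in (_ <= X%:E)%E).
have C0 : 0 <= C.
  by apply: addr_ge0; [rewrite mulr_ge0// sqrtr_ge0|rewrite divr_ge0// ltW].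
have mFs s k : measurable_fun setT (f k s : borelRV_type R m -> R).
  exact: jmeasurable_section.
have bf s k : bounded_on A (f k s).
  by split; [exact: mFs|exists Vmax => a; exact: fV].
have [mpi [pi0 pi1]] := pol.
have mpis s : measurable_fun setT (picp s : borelRV_type R m -> R).
  exact: jmeasurable_section.
have pi_fin s : (intRm (fun a => (\1_A a * picp s a)%:E) < +oo)%E by rewrite pi1 ltry.
(* Both expectations are finite, so the extended-real difference is one of real numbers. *)
have hE k s : (fpol A (f k) picp s - fpol A (f k) (pspi A eta f k) s)%E =
    (wint A (picp s) (f k s) - hedge_avg A eta (fun j => f j s) k)%:E.
  by rewrite (fpol_wint mA mf fV)// (fpol_pspi mA nu0 nu1 eta0 mf fV).
rewrite lee_pdivrMr// -EFinM.
apply: (@sum_occ_exp_le R _ S m mu0 P gamma A picp gamma01 mP mA pol K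
  (fun k s => fpol A (f k) picp s - fpol A (f k) (pspi A eta f k) s)%E Vmax) => //.
- by rewrite mulr_ge0// ltW.
- move=> k; apply: emeasurable_funB.
    by apply: (measurable_fpol mA mf fV) => //; exact: jmeasurable_fun.
  apply: (measurable_fpol mA mf fV).
    exact: (measurable_pspi mA nu0 nu1 eta0 mf fV).
  exact: (pspi_ge0 mA nu0 nu1 eta0 mf fV).
- move=> k s; rewrite hE lee_fin ler_norml.
  have X0 := hedge_avg_ge0 mA nu1 eta0 (mFs s) (fun k => @fV k s) k.
  have XV := hedge_avg_le mA nu0 nu1 eta0 (mFs s) (fun k => @fV k s) k.
  have Y0 := wint_ge0 mA (mpis s) (pi0 s) (pi_fin s) (bf s k).
  have YV : wint A (picp s) (f k s) <= Vmax.
    by apply: wint_policy_le => // a Aa; have /andP[] := fV k s a Aa.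
  by apply/andP; split; lra.
(* At a fixed state the averages under the PSPI policies do not depend on the comparator's action.
   Moved to the right, they form with the rate a constant that bounds the summed critics at every
   action of [A], hence also their [picp]-average. *)
- move=> s; under eq_bigr do rewrite hE.
  rewrite sumEFin lee_fin sumrB lerBlDl.
  rewrite -(wint_sum mA (mpis s) (pi0 s) (pi_fin s) K (bf s)).
  apply: wint_policy_le => //.
  + exact: (bounded_on_sum K (bf s)).
  + rewrite addr_ge0 ?mulr_ge0 ?(ltW KR0)//; apply: sumr_ge0 => k _.
    exact: (hedge_avg_ge0 mA nu1 eta0 (mFs s) (fun k => @fV k s)).
  + move=> a Aa.
    exact: (hedge_regret_tuned mA nu0 nu1 cA dA (mFs s) (fun k => @fV k s)
      (fun k => @fL k s) K0 Aa erefl).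
Qed.
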